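(* Let $X$ be a set, let $p\colon X\times X\to[0,\infty)$ be a felt metric for $X$, let $f\colon X\to X$ be a selfmapping, let $x_0\in X$, and put $x_n=f^n x_0$ for $n\in\mathbb{N}$. Consider the following two conditions. (A) For each $\alpha>0$ there exists an $\epsilon>0$ such that, for all $x,y\in X$, $\alpha-\epsilon<p(y,x)<\alpha+\epsilon$ implies $p(fy,fx)\le\alpha$. (B) For each $\alpha>0$ there exists an $\epsilon>0$ such that, for all $x,y\in X$, $\alpha\le p(y,x)<\alpha+\epsilon$ implies $p(fy,fx)\le\alpha$. Conditions (A) and (B) are equivalent. Moreover, assume that $\lim_{n\to\infty}p(x_{n+1},x_n)=0$ and that (A) or (B) is satisfied. If $(X,p)$ is $0$-complete, then there exists an $x\in X$ such that $\lim_{n\to\infty}p(x_n,x)=p(x,x)=0$ and $fx=x$.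
   Context: A mapping $p\colon X\times X\to[0,\infty)$ is a felt metric for $X$ if all of the following hold: (a) for all $x,y\in X$, $p(x,y)=0$ implies $x=y$ (it is not required that $p(x,x)=0$); (b) $p(x,y)=p(y,x)$ for all $x,y\in X$; (c) for each $\epsilon>0$ there exists a $\delta>0$ such that for all $x,y,z\in X$, $p(z,y)<\delta$ implies $|p(z,x)-p(y,x)|<\epsilon$. The felt metric space $(X,p)$ is $0$-complete if for each sequence $(x_n)_{n\in\mathbb{N}}$ in $X$ such that $\lim_{m,n\to\infty}p(x_n,x_m)=0$ there exists an $x\in X$ for which $\lim_{n\to\infty}p(x_n,x)=0$. Notation: $fx$ means $f(x)$, and $f^n$ is the $n$-th iterate of $f$. *)

(* Defs.v *)
From mathcomp Require Import all_boot all_order all_algebra.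
From mathcomp Require Import all_classical all_reals all_analysis.

Set Implicit Arguments.
Unset Strict Implicit.
Unset Printing Implicit Defensive.

Import Order.TTheory GRing.Theory Num.Theory.
Import numFieldNormedType.Exports.

Local Open Scope classical_set_scope.
Local Open Scope ring_scope.

(* Self-distances p x x are allowed to be positive. *)
Record felt_metric (R : realType) (X : Type) (p : X -> X -> R) : Prop :=
  FeltMetric {
    felt_ge0 : forall x y, 0 <= p x y;
    felt_eq0 : forall x y, p x y = 0 -> x = y;
    felt_sym : forall x y, p x y = p y x;
    felt_unif : forall e : R, 0 < e ->
      exists2 d : R, 0 < d &
        forall x y z, p z y < d -> `|p z x - p y x| < e
  }.

Definition zero_complete (R : realType) (X : Type) (p : X -> X -> R) : Prop :=
  forall u : nat -> X,
    p (u nm.1) (u nm.2) @[nm --> (\oo, \oo)] --> (0 : R) ->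
    exists x : X, p (u n) x @[n --> \oo] --> (0 : R).

Definition condition_A (R : realType) (X : Type) (p : X -> X -> R)
    (f : X -> X) : Prop :=
  forall a : R, 0 < a ->
    exists2 e : R, 0 < e &
      forall x y, a - e < p y x < a + e -> p (f y) (f x) <= a.

Definition condition_B (R : realType) (X : Type) (p : X -> X -> R)
    (f : X -> X) : Prop :=
  forall a : R, 0 < a ->
    exists2 e : R, 0 < e &
      forall x y, a <= p y x < a + e -> p (f y) (f x) <= a.

(* Main.v *)
Require Import Defs.
From mathcomp Require Import all_boot all_order all_algebra.
From mathcomp Require Import all_classical all_reals all_analysis.
From mathcomp Require Import lra.

(** Condition (A) restricted to distances at least [a] is (B).  Conversely, (B)
    taken at the level [a := p y x] says that [f] does not increase positive
    distances, which takes care of the part of (A) below the level [a], as long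
    as the window around [a] stays within the positive reals.

    The orbit is Cauchy by a Meir-Keeler argument.  For a level [a], let [e] be
    the half-width given by (A), and start the tail of the orbit where one step
    is so short that it changes any distance by less than [e] (uniformity of
    the felt metric).  Then [a + e] is a barrier for the distance from a fixed
    orbit point [x_n] to the later points [x_m] ([orbit_barrier]): from below
    the window one step cannot cross it, and from within the window (A) brings
    [p x_(m+1) x_(n+1)] down to [a], from which replacing [x_(n+1)] by [x_n]
    costs less than [e].  As [a] and [e] are arbitrarily small, the double limit
    vanishes, the self-distances on the diagonal included.

    If [x] is the limit given by 0-completeness, uniformity forces [p x x = 0].
    The points [x_(n+1)] also approach [f x]: a positive [p x_n x] does not
    increase under [f], whereas a zero one means [x_n = x], and then
    [p x_(n+1) (f x)] is a self-distance of the orbit, hence small.  Limits in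
    this sense being unique, [f x = x]. *)

Set Implicit Arguments.
Unset Strict Implicit.
Unset Printing Implicit Defensive.

Import Order.TTheory GRing.Theory Num.Theory.
Import numFieldNormedType.Exports.

Local Open Scope classical_set_scope.
Local Open Scope ring_scope.

Lemma cvg0_ge0P (R : realType) (T : Type) (F : set_system T) (g : T -> R) :
  Filter F -> (forall t, 0 <= g t) ->
  g t @[t --> F] --> (0 : R) <->
  (forall e : R, 0 < e -> \forall t \near F, g t < e).
Proof.
move=> FF g0; split=> [/cvgrPdist_lt gF e e0|gF].
  by near do rewrite -[ltLHS]ger0_norm// -normrN -sub0r; exact: gF.
apply/cvgrPdist_lt => e e0; have := gF _ e0.
by apply: filterS => t; rewrite sub0r normrN ger0_norm.
Unshelve. all: by end_near. Qed.

Lemma condition_B_nonexpansive (R : realType) (X : Type) (p : X -> X -> R)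
    (f : X -> X) :
  condition_B p f -> forall x y, 0 < p y x -> p (f y) (f x) <= p y x.
Proof.
move=> hB x y pos; have [e e0 he] := hB _ pos.
by apply: he; rewrite lexx ltrDl.
Qed.

Lemma condition_AB (R : realType) (X : Type) (p : X -> X -> R) (f : X -> X) :
  condition_A p f <-> condition_B p f.
Proof.
split=> h a a0; have [e e0 he] := h _ a0.
  by exists e => // x y /andP[h1 h2]; apply: he; apply/andP; split => //; lra.
(* capping the half-width by [a] keeps the distances in the window positive *)
exists (Num.min e a) => [|x y /andP[h1 h2]]; first by rewrite lt_min e0.
have me : Num.min e a <= e by rewrite ge_min lexx.
have ma : Num.min e a <= a by rewrite ge_min lexx orbT.
have [ap|pa] := leP a (p y x).
  by apply: he; rewrite ap /=; lra.
by apply: (le_trans (condition_B_nonexpansive h _)); lra.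
Qed.

(** Bounding the distances to a fixed orbit point below [a + e], the right end
    of the window of (A), rather than by [a], is what makes the induction on
    [k] go through: one step from inside the window may end above [a], but
    stays below [a + e]. *)
Lemma orbit_barrier (R : realType) (X : Type) (p : X -> X -> R) (f : X -> X)
    (u : nat -> X) (a e d : R) (n k : nat) :
  felt_metric p -> (forall i, u i.+1 = f (u i)) ->
  (forall x y, a - e < p y x < a + e -> p (f y) (f x) <= a) ->
  (forall x y z, p z y < d -> `|p z x - p y x| < e) ->
  (forall i, (n <= i)%N -> p (u i.+1) (u i) < d) ->
  p (u n) (u n) < a + e -> p (u (n + k)%N) (u n) < a + e.
Proof.
move=> hp uS hA hd small base; elim: k => [|k IH]; first by rewrite addn0.
rewrite addnS; have [le|gt] := leP (p (u (n + k)%N) (u n)) (a - e).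
  have e0 : 0 < e by exact: le_lt_trans (hd (u n) _ _ (small n (leqnn n))).
  by have /ltr_normlW := hd (u n) _ _ (small _ (leq_addr k n)); lra.
have := hA (u n) (u (n + k)%N); rewrite gt IH -!uS => /(_ isT) le_a.
have := hd (u (n + k).+1) _ _ (small n (leqnn n)).
rewrite distrC => /ltr_normlW.
rewrite !(felt_sym hp _ (u (n + k).+1)).
by move: le_a; lra.
Qed.

Lemma orbit_cauchy (R : realType) (X : Type) (p : X -> X -> R) (f : X -> X)
    (u : nat -> X) :
  felt_metric p -> (forall i, u i.+1 = f (u i)) -> condition_A p f ->
  p (u n.+1) (u n) @[n --> \oo] --> (0 : R) ->
  forall c : R, 0 < c -> exists N : nat,
    forall m n, (N <= m)%N -> (N <= n)%N -> p (u m) (u n) < c.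
Proof.
move=> hp uS hA /cvg0_ge0P step c c0.
have c20 : 0 < c / 2 by rewrite divr_gt0.
have [e1 e10 he1] := hA _ c20.
pose e := Num.min e1 (c / 2).
have e0 : 0 < e by rewrite lt_min e10.
have ee1 : e <= e1 by rewrite ge_min lexx.
have ec : e <= c / 2 by rewrite ge_min lexx orbT.
have [d d0 hd] := felt_unif hp e0.
(* short steps also serve to start below the barrier, at [p (u n) (u n)] *)
pose d' := Num.min d (c / 2).
have d'0 : 0 < d' by rewrite lt_min d0.
have [N _ hN] := step (fun=> felt_ge0 hp _ _) _ d'0.
have small i : (N <= i)%N -> p (u i.+1) (u i) < d /\ p (u i.+1) (u i) < c / 2.
  by move=> /hN /=; rewrite lt_min => /andP[].
have later n k : (N <= n)%N -> p (u (n + k)%N) (u n) < c.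
  move=> Nn; suff : p (u (n + k)%N) (u n) < c / 2 + e by lra.
  apply: (orbit_barrier (d := d) _ hp uS) => //.
  - by move=> x y /andP[h1 h2]; apply: he1; apply/andP; split; lra.
  - by move=> i ni; have [] := small i (leq_trans Nn ni).
  - have [sd sc] := small n Nn.
    by have := hd (u n) _ _ sd; rewrite distrC => /ltr_normlW; lra.
exists N => m n Nm Nn; have [nm|/ltnW mn] := leqP n m.
  by rewrite -(subnKC nm); exact: later.
by rewrite (felt_sym hp) -(subnKC mn); exact: later.
Qed.

(** Uniformity stands in for the triangle inequality: once [u n] is close to
    [x], the distances [p (u n) y] and [p x y] are nearly equal.  The conclusion
    is a zero distance and not just [x = y] because a point may have a positive
    self-distance; the case [y = x] says that a limit point has none. *)
Lemma felt_limit_dist0 (R : realType) (X : Type) (p : X -> X -> R)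
    (u : nat -> X) (x y : X) :
  felt_metric p -> p (u n) x @[n --> \oo] --> (0 : R) ->
  p (u n) y @[n --> \oo] --> (0 : R) -> p x y = 0.
Proof.
move=> hp /cvg0_ge0P ux /cvg0_ge0P uy.
apply/eqP; rewrite eq_le (felt_ge0 hp) andbT; apply/ler_addgt0Pr => c c0.
have c20 : 0 < c / 2 by rewrite divr_gt0.
have [d d0 hd] := felt_unif hp c20.
have [n [nx ny]] : exists n, p (u n) x < d /\ p (u n) y < c / 2.
  apply: (@filter_ex _ \oo); apply: filterI.
    by apply: ux => // n; exact: felt_ge0 hp _ _.
  by apply: uy => // n; exact: felt_ge0 hp _ _.
by have := hd y _ _ nx; rewrite distrC => /ltr_normlW; lra.
Qed.

Theorem theorem2 (R : realType) (X : Type) (p : X -> X -> R)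
    (hp : felt_metric p) (f : X -> X) (x0 : X) :
  (condition_A p f <-> condition_B p f) /\
  (p (iter n.+1 f x0) (iter n f x0) @[n --> \oo] --> (0 : R) ->
   condition_A p f \/ condition_B p f ->
   zero_complete p ->
   exists x : X,
     [/\ p (iter n f x0) x @[n --> \oo] --> p x x,
         p x x = 0 &
         f x = x]).
Proof.
split; first exact: condition_AB.
move=> step hAB complete.
have hA : condition_A p f by case: hAB => // /condition_AB.
have hB : condition_B p f by exact/condition_AB.
have uS i : iter i.+1 f x0 = f (iter i f x0) by [].
have cauchy := orbit_cauchy hp uS hA step.
have [|x ux] := complete (fun n => iter n f x0).
  apply/cvg0_ge0P => [nm|c c0]; first exact: felt_ge0 hp _ _.
  have [N hN] := cauchy _ c0.
  exists ([set n | (N <= n)%N], [set n | (N <= n)%N]).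
    by split; exists N.
  by move=> [m n] [/= Nm Nn]; exact: hN.
have pxx := felt_limit_dist0 hp ux ux.
exists x; split => //; first by rewrite pxx.
have ufx : p (iter n.+1 f x0) (f x) @[n --> \oo] --> (0 : R).
  apply/cvg0_ge0P => [n|c c0]; first exact: felt_ge0 hp _ _.
  have [N hN] := cauchy _ c0.
  have /cvg0_ge0P near_x := ux.
  have [M _ hM] := near_x (fun=> felt_ge0 hp _ _) _ c0.
  exists (maxn N M) => // n /=; rewrite geq_max => /andP[Nn Mn].
  have [/(felt_eq0 hp) unx|pn0] := eqVneq (p (iter n f x0) x) 0.
    by rewrite -unx -uS; apply: hN; exact: leqW.
  apply: le_lt_trans (hM n Mn).
  apply: (condition_B_nonexpansive hB).
  by rewrite lt_neqAle eq_sym pn0 (felt_ge0 hp).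
apply: (felt_eq0 hp); rewrite (felt_sym hp).
apply: (felt_limit_dist0 (u := fun n => iter n.+1 f x0) hp _ ufx).
by have := ux; rewrite -(cvg_shiftS (fun n => p (iter n f x0) x)).
Qed.
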